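(* There exists a family $\mathcal{E}$ of pairs $(v,w)$ of binary words of the same length such that: (i) for every $(v,w)\in\mathcal{E}$ there is a bijection $\varphi : \Omega_{v,w}(v) \to \Omega_{v,w}(w)$ with $\mathbb{P}_p(\varphi(x)) = \mathbb{P}_p(x)$ for all $x\in\Omega_{v,w}(v)$ and all $p\in(0,1)$; in particular $\mathrm{Win}(v,w;p) = \tfrac12$ for all $p \in (0,1)$; (ii) membership of a pair $(v,w)$ in $\mathcal{E}$ can be decided in time polynomial in the length of the words; (iii) $\mathcal{E} \setminus \mathcal{R}$ is infinite.
   Context: For $p\in(0,1)$, let $\mathbb{P}_p$ denote the law of an i.i.d. sequence $X_1, X_2, \ldots$ of bits with $\mathbb{P}_p(X_i = 1) = p$; for a finite word $u$, $\mathbb{P}_p(u) = p^{\|u\|_1}(1-p)^{\|u\|_0}$, where $\|u\|_a$ is the number of letters of $u$ equal to $a$. For a binary word $u = u_1\cdots u_r$, $\tau_u = \min\{t \in \mathbb{N} : X_{t-r+1}\cdots X_t = u_1\cdots u_r\}$, and $\mathrm{Win}(v,w;p) = \mathbb{P}_p(\tau_v < \tau_w)$. For binary words $v,w$ of the same length, $\Omega_{v,w}(v)$ is the set of finite binary words $u$ that end with $v$, in which $v$ occurs as a contiguous subword only as the suffix, and in which $w$ does not occur as a contiguous subword; $\Omega_{v,w}(w)$ is defined symmetrically; $\Omega^*_{v,w}(v) = \{x : xv \in \Omega_{v,w}(v)\}$ and $\Omega^*_{v,w}(w) = \{x : xw \in \Omega_{v,w}(w)\}$. $\mathcal{R}$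 denotes the family of pairs $(v,w)$ of distinct binary words of the same length with $\Omega^*_{v,w}(v) = \Omega^*_{v,w}(w)$. *)

(* Defs.v *)
From HB Require Import structures.
From mathcomp Require Import all_boot all_order all_algebra.
From mathcomp Require Import all_classical all_reals all_analysis.

Set Implicit Arguments.
Unset Strict Implicit.
Unset Printing Implicit Defensive.

Import Order.TTheory GRing.Theory Num.Theory.

Local Open Scope classical_set_scope.
Local Open Scope ring_scope.

(* Letters: [true] is 1 and [false] is 0. *)
Definition word := seq bool.

Definition wprob (R : realType) (p : R) (u : word) : R :=
  p ^+ count_mem true u * (1 - p) ^+ count_mem false u.

(* [Omega a b] is Omega_{v,w}(a), where {a, b} = {v, w}:
   Omega_{v,w}(v) is [Omega v w] and Omega_{v,w}(w) is [Omega w v]. *)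
Definition Omega (a b : word) : set word :=
  [set u | [/\ suffix a u,
               forall x y : word, u = x ++ a ++ y -> y = [::] &
               ~~ infix b u]].

Definition OmegaStar (a b : word) : set word := [set x | Omega a b (x ++ a)].

Definition Rfam : set (word * word) :=
  [set vw | [/\ vw.1 != vw.2, size vw.1 = size vw.2 &
                OmegaStar vw.1 vw.2 = OmegaStar vw.2 vw.1]].

(* The bit X_{i+1} is [X i]: the sequence is indexed from 0. *)
Definition iid_bits (R : realType) (p : R) (d : measure_display)
    (T : measurableType d) (P : probability T R)
    (X : nat -> {RV P >-> bool}) : Prop :=
  (forall i, P (X i @^-1` [set true]) = p%:E) /\
  (forall (J : seq nat) (A : nat -> set bool), uniq J ->
     P (\bigcap_(j in [set` J]) (X j @^-1` A j)) =
     (\prod_(j <- J) P (X j @^-1` A j))%E).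

(* X_{t-r+1} ... X_t = u, where r is the length of u. *)
Definition occurs_at (u : word) (x : nat -> bool) (t : nat) : Prop :=
  (size u <= t)%N /\ [seq x i | i <- iota (t - size u) (size u)] = u.

(* The value is +oo when u never occurs. *)
Definition tau (R : realType) (u : word) (x : nat -> bool) : \bar R :=
  ereal_inf [set (t%:R)%:E | t in occurs_at u x].

Definition Win (R : realType) (d : measure_display) (T : measurableType d)
    (P : probability T R) (X : nat -> {RV P >-> bool}) (v w : word) : \bar R :=
  P [set o | (tau R v (fun i => X i o) < tau R w (fun i => X i o))%E].

(* Deterministic Turing machines with [tm_tapes.+1] two-way infinite tapes. *)

Inductive move := MoveLeft | Stay | MoveRight.

(* The input alphabet consists of the two bits [Some b] and a separator [None].
   A state q with [tm_answer q = Some b] is halting, with verdict b. *)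
Record TM := {
  tm_tapes : nat;
  tm_state : finType;
  tm_sym : finType;
  tm_blank : tm_sym;
  tm_in : option bool -> tm_sym;
  tm_in_inj : injective tm_in;
  tm_in_blank : forall a, tm_in a <> tm_blank;
  tm_start : tm_state;
  tm_answer : tm_state -> option bool;
  tm_delta : tm_state -> {ffun 'I_tm_tapes.+1 -> tm_sym} ->
             tm_state * {ffun 'I_tm_tapes.+1 -> tm_sym * move}
}.

(* [(l, c, r)]: the head reads c, l lists the cells to its left and r those to
   its right, nearest cell first; all further cells are blank. *)
Definition tape (M : TM) : Type := seq (tm_sym M) * tm_sym M * seq (tm_sym M).

Definition load (M : TM) (s : seq (tm_sym M)) : tape M :=
  ([::], head (tm_blank M) s, behead s).

Definition write_move (M : TM) (tp : tape M) (a : tm_sym M * move) : tape M :=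
  let: (l, _, r) := tp in
  match a.2 with
  | MoveLeft => (behead l, head (tm_blank M) l, a.1 :: r)
  | Stay => (l, a.1, r)
  | MoveRight => (a.1 :: l, head (tm_blank M) r, behead r)
  end.

Definition config (M : TM) : Type :=
  tm_state M * ('I_(tm_tapes M).+1 -> tape M).

Definition tm_step (M : TM) (c : config M) : config M :=
  if tm_answer c.1 is Some _ then c else
  let: (q, act) := tm_delta c.1 [ffun i => (c.2 i).1.2] in
  (q, fun i => write_move (c.2 i) (act i)).

Definition encode_pair (v w : word) : seq (option bool) :=
  map Some v ++ None :: map Some w.

Definition tm_init (M : TM) (s : seq (option bool)) : config M :=
  (tm_start M,
   fun i => if i == ord0 then load (map (@tm_in M) s) else load [::]).

Definition polytime_decidable (E : set (word * word)) : Prop :=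
  exists (M : TM) (c k : nat), forall v w : word,
    exists2 t : nat, (t <= c * (size v + size w) ^ k + c)%N &
      tm_answer (iter t (@tm_step M) (tm_init M (encode_pair v w))).1 =
      Some `[< E (v, w) >].

(* Main.v *)
(* For [A = 001011] and [B = 001101] take the pairs [v = A 1^n B], [w = B 1^n A].
   The factor [00] occurs in these words only at the start of the two blocks, so
   the only overlaps are [v] followed by [w] along [B], and [w] followed by [v]
   along [A].  With [P = A 1^n] and [Q = B 1^n], a word [x v] is then in
   Omega_{v,w}(v) iff [x] contains neither [v] nor [w] and does not end with [Q],
   and symmetrically for [x w] and [P].  Hence [x_0 P^k v |-> x_0 Q^k w], with [k]
   maximal, is a letter-count preserving bijection, whereas [x = P] shows that
   the pair is not in R.  The bijection equates the laws of the first hitting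
   times, and almost surely one of the words occurs.  Membership is decided in
   linear time with one unary counter. *)
Require Import Defs.
From mathcomp Require Import all_boot all_order all_algebra.
From mathcomp Require Import all_classical all_reals all_analysis.
From mathcomp Require Import zify lra.

Set Implicit Arguments.
Unset Strict Implicit.
Unset Printing Implicit Defensive.

Import Order.TTheory GRing.Theory Num.Theory.

Local Open Scope classical_set_scope.
Local Open Scope ring_scope.
Local Open Scope nat_scope.

(** * Overlaps and the exchange bijection *)

Definition avoids (v w : word) : pred word := fun x => ~~ infix v x && ~~ infix w x.

(* Replaces a final [P^k] by [Q^k], for [k <= n] as large as possible. *)
Fixpoint swap_suffix (n : nat) (P Q x : word) : word :=
  if n is m.+1 then
    if suffix P x then swap_suffix m P Q (take (size x - size P) x) ++ Q else x
  else x.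

Definition replace_end (v w P Q u : word) : word :=
  swap_suffix (size u) P Q (take (size u - size v) u) ++ w.

Lemma suffix_same_size (s t x : word) :
  size s = size t -> suffix s x -> suffix t x -> s = t.
Proof.
by move=> st; rewrite !suffixE -st => /eqP e1 /eqP e2; rewrite -e1 e2.
Qed.

(** An occurrence of [a] inside [x] would be followed by the nonempty [y], while [a] may only end
    the word. *)
Lemma Omega_avoids (a b x y : word) :
  Omega a b (x ++ y) -> y != [::] -> avoids a b x.
Proof.
case=> _ only nb ny; rewrite /avoids; apply/andP; split; last first.
  by apply: contra nb; apply: infix_catr.
apply/negP => /infixP[s [s' xE]]; have := only s (s' ++ y).
rewrite xE -!catA => /(_ erefl) /eqP; rewrite -size_eq0 size_cat addn_eq0.
by rewrite !size_eq0 (negbTE ny) andbF.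
Qed.

(* The shape is [v = A M B], [w = B M' A], [P = A M], [Q = B M'].  The last two
   fields express that the only overlaps of [v] and [w] are [A] and [B]. *)
Record linked (v w P Q : word) : Prop := Linked {
  linked_size : size P = size Q;
  linked_pos : 0 < size P;
  linked_neq : P != Q;
  linked_perm : perm_eq P Q;
  linked_perm_words : perm_eq v w;
  linked_v : exists2 B, v = P ++ B & B != [::] /\ prefix B Q;
  linked_w : exists2 A, w = Q ++ A & A != [::] /\ prefix A P;
  linked_star_v : forall x, Omega v w (x ++ v) <-> avoids v w x && ~~ suffix Q x;
  linked_star_w : forall x, Omega w v (x ++ w) <-> avoids v w x && ~~ suffix P x }.

Lemma linked_sym v w P Q : linked v w P Q -> linked w v Q P.
Proof.
case=> sPQ P0 nPQ pPQ pvw hv hw starv starw.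
have avC x : avoids w v x = avoids v w x by rewrite /avoids andbC.
split => //.
- by rewrite -sPQ.
- by rewrite eq_sym.
- by rewrite perm_sym.
- by rewrite perm_sym.
- by move=> x; rewrite avC; exact: starw.
- by move=> x; rewrite avC; exact: starv.
Qed.

(** Induction, stripping one [P] from [x] at a time. An [x] that does not end with [P] satisfies
    both star conditions and is its own image. As [P] is nonempty, the fuel [size x] suffices. *)
Lemma swap_suffixP v w P Q n x : linked v w P Q -> size x <= n ->
  Omega v w (x ++ v) ->
  [/\ Omega w v (swap_suffix n P Q x ++ w), perm_eq (swap_suffix n P Q x) x &
      swap_suffix n Q P (swap_suffix n P Q x) = x].
Proof.
case=> sPQ P0 nPQ pPQ pvw [B vE [B0 BQ]] [A wE [A0 AP]] starv starw.
elim: n x => [|n IHn] x.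
  rewrite leqn0 size_eq0 => /eqP -> /starv/andP[av _]; split => //=.
  by apply/(starw [::]); rewrite av suffixs0 -size_eq0 -lt0n.
move=> xn /[dup] Ov /starv/andP[av nQ] /=; case: ifPn => [|nP]; last first.
  by split=> //; [apply/starw; rewrite av|rewrite (negbTE nQ)].
move=> /suffixP[y xE]; have -> : take (size x - size P) x = y.
  by rewrite xE size_cat addnK take_size_cat.
have avy : avoids v w y && ~~ suffix Q y.
  apply/andP; split.
    by move: av; rewrite xE => /andP[h1 h2]; apply/andP; split;
      [apply: contra h1|apply: contra h2]; apply: infix_catr.
  (* If [y] ended with [Q], then [x = y P] would contain [w = Q A], since [A] is a prefix of [P]. *)
  apply: contraL av => /suffixP[z yE]; rewrite /avoids negb_and !negbK.
  move: AP => /prefixP[M PE]; apply/orP; right; apply/infixP.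
  by exists z, M; rewrite xE yE wE {1}PE -!catA.
have yn : size y <= n by rewrite -ltnS (leq_trans _ xn) // xE size_cat -addn1 leq_add2l.
have [Oy py Ky] := IHn _ yn ((starv y).2 avy).
have suf s : suffix Q (s ++ Q) by apply: suffix_suffix.
rewrite suf size_cat addnK take_size_cat // Ky.
split; last by rewrite xE.
  apply/starw/andP; split.
    (* As [w = Q A] with [A] nonempty, the new word is a proper prefix of the word of [Omega w v]
       given by induction. *)
    have := Omega_avoids (x := swap_suffix n P Q y ++ Q) (y := A).
    by rewrite -catA -wE /avoids andbC; apply.
  apply/negP => sP; move: nPQ.
  by rewrite (suffix_same_size (t := Q) _ sP) ?eqxx.
by rewrite xE; apply: perm_cat => //; rewrite perm_sym.
Qed.

Lemma replace_endP v w P Q u : linked v w P Q -> Omega v w u ->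
  [/\ Omega w v (replace_end v w P Q u), perm_eq (replace_end v w P Q u) u &
      replace_end w v Q P (replace_end v w P Q u) = u].
Proof.
move=> L /[dup] -[/suffixP[x uE] _ _]; rewrite {}uE => Ox.
have sx : size x <= size (x ++ v) by rewrite size_cat leq_addr.
have [Ow px Kx] := swap_suffixP L sx Ox.
have tk (s t : word) : take (size (s ++ t) - size t) (s ++ t) = s.
  by rewrite size_cat addnK take_size_cat.
rewrite /replace_end !tk.
have px' : perm_eq (swap_suffix (size (x ++ v)) P Q x ++ w) (x ++ v).
  by apply: perm_cat => //; rewrite perm_sym (linked_perm_words L).
(* A permutation preserves length, so the inverse map runs with the same fuel. *)
by split=> //; rewrite (perm_size px') Kx.
Qed.

Lemma replace_end_bij v w P Q : linked v w P Q ->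
  set_bij (Omega v w) (Omega w v) (replace_end v w P Q).
Proof.
move=> L; split.
- by move=> u /(replace_endP L)[].
- move=> x y; rewrite !inE => /(replace_endP L)[_ _ Kx] /(replace_endP L)[_ _ Ky].
  by move=> e; rewrite -Kx e Ky.
- move=> y /(replace_endP (linked_sym L))[Oy _ Ky].
  by exists (replace_end w v Q P y).
Qed.

Lemma linked_notin_R v w P Q : linked v w P Q -> ~ Rfam (v, w).
Proof.
case=> sPQ P0 nPQ pPQ pvw [B vE [B0 BQ]] [A wE [A0 AP]] starv starw.
move=> -[/= _ svw] /seteqP[/(_ P) h _]; have /starw/andP[_] : Omega w v (P ++ w).
  apply: h; apply/starv/andP; split.
    (* [P] is strictly shorter than both words, so it contains neither. *)
    have sz s t : size s < size t -> ~~ infix t s.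
      by rewrite ltnNge; apply: contra => /size_infix.
    apply/andP; split; apply: sz; rewrite -?svw vE size_cat.
      by rewrite -[X in X < _]addn0 ltn_add2l lt0n size_eq0.
    by rewrite -[X in X < _]addn0 ltn_add2l lt0n size_eq0.
  apply: contra nPQ => sP.
  by rewrite (suffix_same_size (t := P) _ sP) ?suffix_refl.
by rewrite suffix_refl.
Qed.

(** * The concrete words and their overlaps *)

(** The blocks are permutations of each other, and both end in 1, so that no [00] arises at a
    junction. *)
Definition blockA : word := [:: false; false; true; false; true; true].
Definition blockB : word := [:: false; false; true; true; false; true].

Definition spaced (A B : word) (n : nat) : word := A ++ nseq n true ++ B.

(* Overlaps are located by [00], which occurs in each of these words only at the
   start of the two blocks. *)
Lemma spaced_overlap A B A' B' n k :
  (A = blockA /\ B = blockB) \/ (A = blockB /\ B = blockA) ->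
  (A' = blockA /\ B' = blockB) \/ (A' = blockB /\ B' = blockA) ->
  0 < k < n + 12 ->
  drop k (spaced A B n) = take (n + 12 - k) (spaced A' B' n) -> k = n + 6 /\ B = A'.
Proof.
move=> hAB hAB' /andP[k0 kn] e.
have sz : size (spaced A B n) = n + 12.
  by case: hAB => -[-> ->]; rewrite !size_cat size_nseq /=; lia.
have h i : nth false (spaced A B n) (k + i) =
    if i < n + 12 - k then nth false (spaced A' B' n) i else false.
  rewrite -nth_drop e; case: ltnP => hi; first by rewrite nth_take.
  by rewrite nth_default // size_take; case: ifP; lia.
have h0 : nth false (spaced A B n) k = false.
  rewrite -[X in nth _ _ X]addn0 h; case: ifP => // _.
  by case: hAB' => -[-> ->].
have h1 : k.+1 < n + 12 -> nth false (spaced A B n) k.+1 = false.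
  move=> k1; rewrite -[X in nth _ _ X]addn1 h ifT; last by lia.
  by case: hAB' => -[-> ->].
(* Letter [k] is 0, and so is letter [k + 1] if it exists. With [k > 0] this excludes the first
   block and the run of 1s, and leaves only the offset [m = 0] in the second block. *)
have keq : k = n + 6.
  have sA : size A = 6 by case: hAB => -[-> _].
  move: h0 h1; rewrite /spaced !nth_cat sA !size_nseq !nth_nseq.
  case: ifP => k6.
    move=> h0 /(_ _); have -> : k.+1 < n + 12 by lia.
    move=> /(_ isT); case: (ltnP k.+1 6) => k5.
      by case: hAB h0 => -[-> _]; move: k k0 k5 {e kn h k6} => [|[|[|[|[|]]]]].
    have k5' : k = 5 by lia.
    by move: h0; rewrite k5'; case: hAB => -[-> _].
  case: ifP => k6n; first by rewrite k6n.
  have [m km] : exists m, k = n + 6 + m by exists (k - (n + 6)); lia.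
  have -> : k - 6 - n = m by lia.
  have -> : k.+1 < 6 = false by lia.
  have -> : k.+1 - 6 < n = false by lia.
  have -> : k.+1 - 6 - n = m.+1 by lia.
  have -> : k.+1 < n + 12 = (m < 5) by lia.
  have m6 : m < 6 by lia.
  rewrite km => h0 h1; suff -> : m = 0 by rewrite addn0.
  by case: hAB h0 h1 => -[_ ->]; move: m m6 {km} => [|[|[|[|[|[|]]]]]] //= _ _ /(_ isT).
split=> //; move: e; rewrite keq.
have -> : n + 12 - (n + 6) = 6 by lia.
have -> : drop (n + 6) (spaced A B n) = B.
  rewrite /spaced catA drop_size_cat // size_cat size_nseq addnC.
  by case: hAB => -[-> _].
by move=> ->; rewrite take_size_cat //; case: hAB' => -[-> _].
Qed.

Lemma size_spaced A B n : size (spaced A B n) = size A + n + size B.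
Proof. by rewrite !size_cat size_nseq addnA. Qed.

(** If [x] ended with [B 1^n], the block [A] opening [v] would complete an occurrence of [w].
    Conversely, an unwanted occurrence across the boundary is an overlap, and [spaced_overlap]
    leaves only that one. *)
Lemma spaced_star A B n x :
  (A = blockA /\ B = blockB) \/ (A = blockB /\ B = blockA) ->
  let v := spaced A B n in let w := spaced B A n in
  Omega v w (x ++ v) <-> avoids v w x && ~~ suffix (B ++ nseq n true) x.
Proof.
move=> hAB v w.
have [vE wE] : v = spaced A B n /\ w = spaced B A n by [].
clearbody v w.
have [sA sB nAB] : [/\ size A = 6, size B = 6 & A <> B] by case: hAB => -[-> ->].
have hBA : (B = blockA /\ A = blockB) \/ (B = blockB /\ A = blockA).
  by case: hAB => -[]; [right|left].
have sv : size v = n + 12 by rewrite vE size_spaced sA sB; lia.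
have sw : size w = n + 12 by rewrite wE size_spaced sA sB; lia.
have nvw : v <> w by move=> /(congr1 (take 6)); rewrite vE wE /spaced !take_size_cat ?sA ?sB.
split=> [Ov|/andP[/andP[nv nw] nQ]].
  have v0 : v != [::] by apply/eqP => v0; move: sv; rewrite v0 /=; lia.
  rewrite (Omega_avoids Ov v0) /=.
  apply/negP => /suffixP[y xE]; case: Ov => _ _ /negP; apply; apply/infixP.
  by exists y, (nseq n true ++ B); rewrite xE vE wE /spaced -!catA.
(* An occurrence of [c] in [x ++ v] that is neither inside [x] nor the final [v]
   straddles the boundary. *)
have occ c a b : (c = v) \/ (c = w) -> x ++ v = a ++ c ++ b -> c = v /\ b = [::].
  move=> hc e.
  have sc : size c = n + 12 by case: hc => ->.
  have := congr1 size e; rewrite !size_cat sv sc => sab.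
  case: (posnP (size b)) => [/size0nil b0|b0].
    split=> //; move: e sab; rewrite b0 cats0 /= => e sab.
    have := congr1 (drop (size x)) e; rewrite drop_size_cat // drop_size_cat //; lia.
  (* If at least [n + 12] letters follow [c], then [c] lies inside [x]. *)
  have [bn|bn] := leqP (n + 12) (size b).
    have xE : x = a ++ c ++ take (size x - (size a + size c)) b.
      have := congr1 (take (size x)) e; rewrite take_size_cat // catA.
      rewrite take_cat size_cat ifF; last by lia.
      by rewrite -catA.
    have : infix c x by rewrite xE; apply: infix_infix.
    by case: hc => ->; rewrite ?(negbTE nv) ?(negbTE nw).
  have xa : size x = size a + size b by lia.
  have xE : x = a ++ take (size b) c.
    have := congr1 (take (size x)) e; rewrite take_size_cat // take_cat xa ifF; last lia.
    by rewrite addKn takel_cat //; lia.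
  have ov : drop (size b) c = take (n + 12 - size b) v.
    have := congr1 (take (n + 12 - size b) \o drop (size x)) e => /=.
    rewrite drop_size_cat // => ->; rewrite drop_cat xa ifF; last lia.
    rewrite addKn drop_cat sc bn take_cat size_drop sc ltnn subnn take0.
    by rewrite cats0.
  have hk : 0 < size b < n + 12 by rewrite b0.
  (* [c = v] would force [A = B]; [c = w] forces the part of [w] inside [x] to be [B 1^n], a suffix
     of [x]. *)
  case: hc => cE; move: ov xE; rewrite {}cE.
    by rewrite vE => /(spaced_overlap hAB hAB hk)[_ BA]; case: nAB.
  rewrite vE wE => /(spaced_overlap hBA hAB hk)[k6 _] xE; case/negP: nQ.
  rewrite xE k6 /spaced catA take_size_cat ?suffix_suffix //.
  by rewrite size_cat size_nseq sB addnC.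
split; first exact: suffix_suffix.
  by move=> a b /occ[|//]; left.
by apply/infixP => -[a [b /occ[|wv _]]]; [right|case: nvw].
Qed.

Lemma spaced_linked n :
  linked (spaced blockA blockB n) (spaced blockB blockA n)
         (blockA ++ nseq n true) (blockB ++ nseq n true).
Proof.
split.
- by rewrite !size_cat.
- by [].
- by rewrite eqseq_cat.
- by rewrite perm_cat2r.
- by apply/permP => a; rewrite !count_cat; lia.
- by exists blockB; rewrite ?catA // prefix_prefix.
- by exists blockA; rewrite ?catA // prefix_prefix.
- by move=> x; apply: spaced_star; left.
- move=> x; have := @spaced_star blockB blockA n x (or_intror (conj erefl erefl)).
  by rewrite /= /avoids [X in X && ~~ suffix _ _]andbC.
Qed.

(** * Deciding the family with a counter machine *)

(** [Expect (Some None)] tests the separator and [Expect None] the end of the input. [Push] adds a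
    maximal run of 1s to the counter; [Pop] requires the next run to have exactly the stored
    length. *)
Inductive instr := Expect of option (option bool) | Push | Pop.

Definition ones (s : seq (option bool)) : nat := find (predC1 (Some true)) s.

Lemma ones0 s : ohead s != Some (Some true) -> ones s = 0.
Proof. by case: s => // x s; rewrite /ones /= (inj_eq (@Some_inj _)) => ->. Qed.

Fixpoint accepts (pr : seq instr) (k : nat) (s : seq (option bool)) : bool :=
  match pr with
  | [::] => true
  | Expect a :: pr => (ohead s == a) && accepts pr k (behead s)
  | Push :: pr => accepts pr (k + ones s) (drop (ones s) s)
  | Pop :: pr => (ones s == k) && accepts pr 0 (drop (ones s) s)
  end.

(* [inl] halts with a verdict; [inr next] tells whether to go on to the next
   instruction.  The two moves are those of tapes 0 and 1, and [None] is the
   blank symbol. *)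
Definition control (i : option instr) (a b : option (option bool)) :
    (bool + bool) * (move * move) :=
  match i with
  | None => (inl true, (Stay, Stay))
  | Some (Expect c) => if a == c then (inr true, (MoveRight, Stay))
                       else (inl false, (Stay, Stay))
  | Some Push => if a == Some (Some true) then (inr false, (MoveRight, MoveRight))
                 else (inr true, (Stay, Stay))
  | Some Pop => if a == Some (Some true) then
                  if b == None then (inr false, (MoveRight, MoveLeft))
                  else (inl false, (Stay, Stay))
                else if b == None then (inl false, (Stay, Stay))
                else (inr true, (Stay, Stay))
  end.

Lemma onth_drop (T : Type) (s : seq T) i : i < size s ->
  exists2 x, onth s i = Some x & drop i s = x :: drop i.+1 s.
Proof.
elim: s i => [|x s IHs] [|i] //=; first by exists x; rewrite ?drop0.
by rewrite ltnS => /IHs[y]; exists y.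
Qed.

(* A counter machine with the program [pr]: tape 0 is the input, and the counter
   is the distance of the head of tape 1 from the only nonblank cell, which is
   marked in the first step. *)
Section CounterMachine.
Variable pr : seq instr.

(** [inl b] has halted, [inr None] is the initial state that marks tape 1, and [inr (Some i)]
    executes instruction [i], where [i = size pr] is the end of the program. *)
Definition cm_state : finType := (bool + option 'I_(size pr).+1)%type.

Definition cm_delta (q : cm_state) (f : {ffun 'I_2 -> option (option bool)}) :
    cm_state * {ffun 'I_2 -> option (option bool) * move} :=
  match q with
  | inl b => (q, [ffun j => (f j, Stay)])
  | inr None => (inr (Some ord0),
                 [ffun j => (if j == ord0 then f j else Some None, Stay)])
  | inr (Some i) =>
      let: (r, (m0, m1)) := control (onth pr i) (f ord0) (f ord_max) in
      (match r with
       | inl b => inl b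
       | inr next => inr (Some (if next then inord i.+1 else i))
       end, [ffun j => (f j, if j == ord0 then m0 else m1)])
  end.

Lemma cm_in_blank (a : option bool) : Some a <> None. Proof. by []. Qed.

Definition counter_machine : TM := {|
  tm_tapes := 1;
  tm_state := cm_state;
  tm_sym := option (option bool);
  tm_blank := None;
  tm_in := Some;
  tm_in_inj := @Some_inj _;
  tm_in_blank := cm_in_blank;
  tm_start := inr None;
  tm_answer := fun q => if q is inl b then Some b else None;
  tm_delta := cm_delta |}.

(** The loop invariant: instruction [i] comes next, [s] is the unread input, [k] the counter. The
    last equation reads tape 1 leftwards from the head: [k] blanks, then the mark [Some None]. *)
Definition cm_run (i : nat) (k : nat) (s : seq (option bool))
    (c : config counter_machine) : Prop :=
  exists l0 l1 b j,
    [/\ i <= size pr, c.1 = inr (Some (inord i)),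
        c.2 ord0 = (l0, head None (map Some s), behead (map Some s)),
        c.2 ord_max = (l1, b, nseq j None) &
        b :: l1 = rcons (nseq k None) (Some None)].

Let M := counter_machine.
Let step := @tm_step M.

Definition cm_halts (n : nat) (c : config M) (b : bool) : Prop :=
  exists2 t, t <= n.+1 & tm_answer (iter t step c).1 = Some b.

(** Each non-halting step consumes an input symbol or passes to the next instruction, so
    [size s + (size pr - i)] decreases; one more step halts. *)
Lemma cm_correct i k s c : cm_run i k s c ->
  cm_halts (size s + (size pr - i)) c (accepts (drop i pr) k s).
Proof.
have [n] := ubnP (size s + (size pr - i)).
elim: n => // n IHn in i k s c *; rewrite ltnS => le_n run.
have go i' k' s' : accepts (drop i' pr) k' s' = accepts (drop i pr) k s ->
    size s' + (size pr - i') < size s + (size pr - i) ->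
    cm_run i' k' s' (step c) ->
    cm_halts (size s + (size pr - i)) c (accepts (drop i pr) k s).
  move=> <- lt_m /IHn[|t le_t tE]; first exact: leq_trans lt_m le_n.
  by exists t.+1; [lia | rewrite iterSr].
have halt b : (step c).1 = inl b -> b = accepts (drop i pr) k s ->
    cm_halts (size s + (size pr - i)) c (accepts (drop i pr) k s).
  by move=> h <-; exists 1; rewrite ?ltnS //= h.
case: run => l0 [l1 [b [j [ip c1 c20 c21 cb]]]].
have i_ord : nat_of_ord (inord i : 'I_(size pr).+1) = i by rewrite inordK.
(* The head of tape 1 sees a blank exactly when it is off the mark. *)
have bE : (b == None) = (0 < k) by case: k cb {go halt} => [|k] [-> _].
pose a : option (option bool) := head None (map Some s).
have stepE : step c =
    (let: (r, (m0, m1)) := control (onth pr i) a b in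
     (match r with
      | inl b => inl b
      | inr next => inr (Some (if next then inord i.+1 else inord i))
      end, fun j => write_move (M := M) (c.2 j)
             ((c.2 j).1.2, if j == ord0 then m0 else m1))).
  rewrite /step /tm_step c1 /= i_ord !ffunE c20 c21 /= -/a.
  case: (control _ _ _) => r [m0 m1]; congr (_, _).
  by apply/funext => x; rewrite !ffunE.
have [ib|ip'] := leqP (size pr) i.
  apply: (halt true); last by rewrite drop_oversize.
  by rewrite stepE onth_default.
have [ins insE dropE] := onth_drop ip'.
rewrite insE in stepE.
have stepH b' m : control (Some ins) a b = (inl b', m) -> (step c).1 = inl b'.
  by move=> e; rewrite stepE e; case: m {e}.
have stepR r m0 m1 : control (Some ins) a b = (inr r, (m0, m1)) ->
    [/\ (step c).1 = inr (Some (inord (if r then i.+1 else i))),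
        (step c).2 ord0 = write_move (M := M) (c.2 ord0) (a, m0) &
        (step c).2 ord_max = write_move (M := M) (c.2 ord_max) (b, m1)].
  by move=> e; rewrite stepE e /= c20 c21; case: (r).
rewrite dropE in go halt *; clear stepE insE.
case: ins dropE => [x||] dropE in go halt stepH stepR *.
- have aE : a = ohead s by rewrite /a; case: (s).
  rewrite /= -aE in go halt stepH stepR *.
  case ax: (a == x) in go halt stepH stepR *; last first.
    by apply: (halt false) => //; apply: stepH.
  have [s1 s2 s3] := stepR _ _ _ erefl.
  apply: (go i.+1 k (behead s)) => //.
    by rewrite size_behead; lia.
  exists (a :: l0), l1, b, j; split => //; last by rewrite s3 c21.
  by rewrite s2 c20 /= behead_map.
- rewrite /= in stepH stepR *; case aT: (a == Some (Some true)) in stepH stepR *.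
    have [s' sE] : exists s', s = Some true :: s'.
      by move: aT; rewrite /a; case: (s) => // y s' /eqP[->]; exists s'.
    rewrite sE /= in go c20 *; have [s1 s2 s3] := stepR _ _ _ erefl.
    apply: (go i k.+1 s') => //.
      by rewrite dropE /= addSnnS.
    exists (Some (Some true) :: l0), (b :: l1), None, j.-1; split => //.
    + by rewrite s2 c20 /=; move: aT; rewrite /a sE.
    + by rewrite s3 c21 /=; case: (j).
    + by rewrite cb.
  have s0 : ones s = 0.
    by apply: ones0; move: aT; rewrite /a; case: (s) => //= y s' ->.
  rewrite /= s0 addn0 drop0 in go *; have [s1 s2 s3] := stepR _ _ _ erefl.
  apply: (go i.+1 k s) => //; first by lia.
  by exists l0, l1, b, j; split => //; rewrite ?s2 ?s3 ?c20 ?c21.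
- rewrite /= in stepH stepR *; case aT: (a == Some (Some true)) in stepH stepR *.
    have [s' sE] : exists s', s = Some true :: s'.
      by move: aT; rewrite /a; case: (s) => // y s' /eqP[->]; exists s'.
    rewrite sE /= in go halt c20 *.
    (* A 1 is read with the counter at zero: the run is too long. *)
    case: k cb bE go halt => [|k] cb bE go halt.
      by apply: (halt false) => //; apply: stepH; rewrite bE.
    rewrite bE in stepR; have [s1 s2 s3] := stepR _ _ _ erefl.
    apply: (go i k s') => //.
      by rewrite dropE.
    case: cb => _ cb.
    exists (Some (Some true) :: l0), (behead l1), (head None l1), j.+1; split => //.
    + by rewrite s2 c20 /=; move: aT; rewrite /a sE.
    + by rewrite s3 c21 /=; move/eqP: bE => ->.
    + by rewrite cb; case: (k).
  have s0 : ones s = 0.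
    by apply: ones0; move: aT; rewrite /a; case: (s) => //= y s' ->.
  rewrite /= s0 drop0 in go halt *.
  (* The run has ended: a positive counter means that it was too short. *)
  case: k cb bE go halt => [|k] cb bE go halt; last first.
    by apply: (halt false) => //; apply: stepH; rewrite bE.
  rewrite bE in stepR; have [s1 s2 s3] := stepR _ _ _ erefl.
  apply: (go i.+1 0 s) => //; first by lia.
  by exists l0, l1, b, j; split => //; rewrite ?s2 ?s3 ?c20 ?c21.
Qed.

Lemma cm_decides s :
  exists2 t, t <= size s + size pr + 2 &
    tm_answer (t := M) (iter t step (tm_init M s)).1 = Some (accepts pr 0 s).
Proof.
have run : cm_run 0 0 s (step (tm_init M s)).
  exists [::], [::], (Some None), 0; split=> //=.
  - by congr (inr (Some _)); apply: val_inj; rewrite /= inordK.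
  - by rewrite !ffunE.
  - by rewrite !ffunE.
have [t tE] := cm_correct run; rewrite drop0 => h.
by exists t.+1; [lia | rewrite iterSr].
Qed.

End CounterMachine.

(** * The program recognising the family *)

Definition spaced_program (A B : word) : seq instr :=
  map (Expect \o Some \o Some) A ++ Push :: map (Expect \o Some \o Some) B ++
  Expect (Some None) ::
  map (Expect \o Some \o Some) B ++ Pop :: map (Expect \o Some \o Some) A ++
  [:: Expect None].

Lemma accepts_word (a : word) pr k s :
  accepts (map (Expect \o Some \o Some) a ++ pr) k s <->
  exists2 s', s = map Some a ++ s' & accepts pr k s'.
Proof.
elim: a s => [|x a IHa] s /=; first by split=> [|[s' ->]//]; exists s.
split=> [/andP[/eqP]|[s' ->] h]; last by rewrite eqxx /=; apply/IHa; exists s'.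
by case: s => // y s [->] /= /IHa[s' -> h]; exists s'.
Qed.

Lemma onesP s : exists2 s', s = nseq (ones s) (Some true) ++ s' &
  drop (ones s) s = s'.
Proof.
elim: s => [|x s [s' sE dE]]; first by exists [::].
rewrite /ones /=; case: eqP => [->|_] /=; last by exists (x :: s).
by exists s' => //; rewrite {1}sE.
Qed.

Lemma ones_nseq n s : ohead s != Some (Some true) ->
  ones (nseq n (Some true) ++ s) = n.
Proof.
move=> hs; elim: n => [|n IHn]; first exact: ones0.
by rewrite /ones /= -/(ones _) IHn.
Qed.

Lemma encode_pair_inj v w v' w' :
  encode_pair v w = encode_pair v' w' -> v = v' /\ w = w'.
Proof.
rewrite /encode_pair; elim: v v' => [|x v IHv] [|y v'] //=.
  by case=> /(inj_map (@Some_inj _)).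
by case=> -> /IHv[-> ->].
Qed.

(** Since both blocks start with 0, the maximal runs of 1s met by [Push] and [Pop] on such a pair
    are exactly the factors [1^n]. Conversely, [n] is the length counted by [Push]. *)
Lemma spaced_programP A B v w :
  ohead A = Some false -> ohead B = Some false ->
  accepts (spaced_program A B) 0 (encode_pair v w) <->
  exists n, v = spaced A B n /\ w = spaced B A n.
Proof.
move=> hA hB.
have noones (C : word) s : ohead C = Some false ->
    ohead (map Some C ++ s) != Some (Some true) by case: C => // _ C [->].
split=> [|[n [-> ->]]]; last first.
  rewrite /encode_pair /spaced !map_cat !map_nseq /spaced_program.
  apply/accepts_word; rewrite -catA; eexists; first by [].
  rewrite /= -!catA ones_nseq ?noones // drop_size_cat ?size_nseq //.
  apply/accepts_word; eexists; first by [].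
  apply/accepts_word; eexists; first by [].
  rewrite -[map Some A]cats0 /= ones_nseq ?noones // eqxx drop_size_cat ?size_nseq //.
  by apply/accepts_word; exists [::].
rewrite /spaced_program => /accepts_word[s1 vE /=].
have [s2 s1E ->] := onesP s1; set n := ones s1 in s1E *; rewrite add0n.
move=> /accepts_word[s3 s2E] /=.
case: s3 s2E => // x s3 s2E /andP[/eqP[xE]]; rewrite {}xE in s2E *.
move=> /accepts_word[s4 /= s3E] /= /andP[/eqP n4].
have [s5 s4E ->] := onesP s4; rewrite n4 in s4E.
move=> /accepts_word[s6 s5E] /=.
case: s6 s5E => // s5E _.
exists n; apply: encode_pair_inj.
rewrite vE s1E s2E s3E s4E s5E /encode_pair /spaced !map_cat !map_nseq.
by rewrite cats0 -!catA.
Qed.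

Lemma spaced_polytime (A B : word) :
  ohead A = Some false -> ohead B = Some false ->
  polytime_decidable (range (fun n => (spaced A B n, spaced B A n))).
Proof.
move=> hA hB; exists (counter_machine (spaced_program A B)).
(* The input has length |v| + |w| + 1, so [cm_decides] bounds the time by |v| + |w| + N + 3 for a
   program of length N. *)
exists (size (spaced_program A B) + 3), 1 => v w.
have [t tle tE] := cm_decides (spaced_program A B) (encode_pair v w).
exists t; last first.
  rewrite {}tE; congr Some; apply/idP/asboolP => [/(spaced_programP v w hA hB)|].
    by case=> n [-> ->]; exists n.
  by case=> n _ [<- <-]; apply/spaced_programP => //; exists n.
apply: leq_trans tle _; rewrite /encode_pair size_cat /= !size_map expn1.
move: (size (spaced_program A B)) => N; nia.
Qed.

(** * First occurrence times *)

Lemma mkseq_occurs (x : nat -> bool) u k a b :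
  mkseq x k = a ++ u ++ b -> occurs_at u x (size a + size u) /\ size a + size u <= k.
Proof.
move=> e; have sk : k = size a + (size u + size b).
  by rewrite -(size_mkseq x k) e !size_cat.
split; last by rewrite sk addnA leq_addr.
split; first exact: leq_addl.
rewrite addnK; move: e; rewrite /mkseq sk !iotaD !map_cat add0n.
move=> /eqP; rewrite eqseq_cat ?size_map ?size_iota // => /andP[_].
by rewrite eqseq_cat ?size_map ?size_iota // => /andP[/eqP].
Qed.

Lemma occurs_suffix (x : nat -> bool) u k : occurs_at u x k -> suffix u (mkseq x k).
Proof.
move=> [uk uE]; rewrite -[u in suffix u _]uE /mkseq -{2}(subnK uk) iotaD map_cat add0n.
exact: suffix_suffix.
Qed.

(** A factor of the prefix of length [k] is an occurrence ending at some time at most [k]; this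
    translates [Omega] into hitting times. *)
Lemma Omega_mkseq (x : nat -> bool) v w k : Omega v w (mkseq x k) <->
  [/\ occurs_at v x k, forall t, t < k -> ~ occurs_at v x t &
      forall t, t <= k -> ~ occurs_at w x t].
Proof.
have pre t : t <= k -> exists c, mkseq x k = mkseq x t ++ c.
  move=> tk; exists (map x (iota t (k - t))).
  by rewrite /mkseq -map_cat -iotaD subnKC.
have occ u t : t <= k -> occurs_at u x t -> exists2 a, mkseq x t = a ++ u &
    exists c, mkseq x k = a ++ u ++ c.
  move=> tk /occurs_suffix/suffixP[a aE]; exists a => //.
  by have [c ->] := pre _ tk; exists c; rewrite aE -catA.
split=> [[sv only nw]|[ov nv nw]].
  split.
  - case/suffixP: sv => a; rewrite -[v in a ++ v]cats0 => aE.
    have [ou _] := mkseq_occurs aE.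
    by move: ou; rewrite -size_cat -(cats0 v) -aE size_mkseq.
  - move=> t tk /(occ _ _ (ltnW tk))[a tE [c kE]].
    have c0 := only _ _ kE; have := size_mkseq x k.
    by rewrite kE c0 cats0 -tE size_mkseq => e; rewrite e ltnn in tk.
  - move=> t tk /(occ _ _ tk)[a _ [c kE]]; case/negP: nw.
    by apply/infixP; exists a, c.
split; first exact: occurs_suffix.
  move=> a b e; have [ou le_k] := mkseq_occurs e.
  move: le_k; rewrite leq_eqVlt => /orP[/eqP ek|/nv //].
  apply/size0nil; have := size_mkseq x k; rewrite e !size_cat; lia.
by apply/infixP => -[a [b e]]; have [ou /nw] := mkseq_occurs e.
Qed.

Lemma Omega_mkseq_inj (x : nat -> bool) v w k l :
  Omega v w (mkseq x k) -> Omega v w (mkseq x l) -> k = l.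
Proof.
move=> /Omega_mkseq[ok nk _] /Omega_mkseq[ol nl _].
by have [/nl|/nk|] := ltngtP k l.
Qed.

(** [k] is the first time at which either word occurs; distinct words of equal length cannot end at
    the same time. *)
Lemma Omega_exhaust (x : nat -> bool) v w N : v != w -> size v = size w ->
  infix v (mkseq x N) ->
  exists k, Omega v w (mkseq x k) \/ Omega w v (mkseq x k).
Proof.
move=> nvw svw vN.
have : exists t, `[< occurs_at v x t \/ occurs_at w x t >].
  by case/infixP: vN => a [b /mkseq_occurs[ou _]]; eexists; apply/asboolP; left; exact: ou.
move=> /ex_minnP[k /asboolP vwk kmin]; exists k.
have nocc t : t < k -> ~ occurs_at v x t /\ ~ occurs_at w x t.
  rewrite ltnNge => /negP tk; split=> o; apply/tk/kmin/asboolP; first by left.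
  by right.
have not_both : occurs_at v x k -> occurs_at w x k -> False.
  by move=> [_ vE] [_ wE]; move/eqP: nvw; apply; rewrite -vE -wE svw.
case: vwk => o; [left|right]; apply/Omega_mkseq; split => // t.
- by move=> /nocc[].
- rewrite leq_eqVlt => /orP[/eqP ->|/nocc[]//] o'; exact: not_both.
- by move=> /nocc[].
- rewrite leq_eqVlt => /orP[/eqP ->|/nocc[]//] o'; exact: not_both.
Qed.

(** Times are integers, so a finite infimum is attained at the first occurrence, which serves as
    [k]; absence of [w] up to [k] puts [tau R w x] at [k + 1] or later. *)
Lemma tau_ltP (R : realType) (x : nat -> bool) v w :
  (tau R v x < tau R w x)%E <-> exists k, Omega v w (mkseq x k).
Proof.
have tau_le u t : occurs_at u x t -> (tau R u x <= (t%:R)%:E)%E.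
  by move=> o; apply: ereal_inf_lbound; exists t.
have tau_ge u t : (forall s, s < t -> ~ occurs_at u x s) -> ((t%:R)%:E <= tau R u x)%E.
  move=> h; apply: le_ereal_inf_tmp => _ [s o <-]; rewrite lee_fin ler_nat leqNgt.
  by apply/negP => /h.
split=> [lt_vw|[k /Omega_mkseq[ov _ nw]]]; last first.
  apply: le_lt_trans (tau_le _ _ ov) _.
  apply: lt_le_trans (tau_ge w k.+1 nw); by rewrite lte_fin ltr_nat.
have : exists t, `[< occurs_at v x t >].
  by have [_ [t o _] _] := ereal_inf_lt lt_vw; exists t; apply/asboolP.
move=> /ex_minnP[k /asboolP ov kmin]; exists k.
apply/Omega_mkseq; split => // t.
  by move=> tk o; move: tk; rewrite ltnNge kmin //; apply/asboolP.
move=> tk /tau_le le_w; have := lt_le_trans lt_vw le_w.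
apply/negP; rewrite -leNgt; apply: le_trans (tau_ge v k _); first by rewrite lee_fin ler_nat.
by move=> s sk o; move: sk; rewrite ltnNge kmin //; apply/asboolP.
Qed.

(* Laws of words and winning probabilities *)
Local Close Scope nat_scope.

Lemma wprobE (R : realType) (p : R) u :
  wprob p u = \prod_(b <- u) (if b then p else 1 - p).
Proof.
elim: u => [|b u IHu]; first by rewrite big_nil /wprob !expr0 mulr1.
rewrite big_cons -IHu /wprob /=; case: b => /=.
  by rewrite add1n add0n exprS mulrA.
by rewrite add1n add0n exprS mulrCA.
Qed.

Lemma wprob_cat (R : realType) (p : R) u v :
  wprob p (u ++ v) = wprob p u * wprob p v.
Proof. by rewrite !wprobE big_cat. Qed.

Lemma wprob_gt0 (R : realType) (p : R) u : 0 < p < 1 -> 0 < wprob p u.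
Proof. by case/andP=> p0 p1; rewrite mulr_gt0 ?exprn_gt0 ?subr_gt0. Qed.

Lemma wprob_perm (R : realType) (p : R) u v : perm_eq u v -> wprob p u = wprob p v.
Proof. by move=> /permP uv; rewrite /wprob !uv. Qed.

Section IidBits.
Variables (R : realType) (p : R) (d : measure_display) (T : measurableType d).
Variables (P : probability T R) (X : nat -> {RV P >-> bool}).
Hypothesis iidX : iid_bits p X.

Let bits (k : nat) (o : T) : word := mkseq (X^~ o) k.

Lemma measurable_bit i (B : set bool) : measurable (X i @^-1` B).
Proof. exact: measurable_funPTI. Qed.

Lemma bit_law i b : P (X i @^-1` [set b]) = (if b then p else 1 - p)%:E.
Proof.
have h : P (X i @^-1` [set true]) = p%:E by apply iidX.
case: b => //; have -> : X i @^-1` [set false] = ~` (X i @^-1` [set true]).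
  by apply/seteqP; split=> o /=; case: (X i o).
by rewrite probability_setC ?h //; exact: measurable_bit.
Qed.

Lemma bits_setE k u : size u = k ->
  [set o | bits k o = u] =
  \bigcap_(j in [set` iota 0 k]) (X j @^-1` [set nth false u j]).
Proof.
move=> uk; apply/seteqP; split=> o /=.
  move=> <- j /=; rewrite mem_iota add0n => /andP[_ jk] /=.
  by rewrite nth_mkseq.
move=> h; apply: (@eq_from_nth _ false); first by rewrite size_mkseq.
move=> j; rewrite size_mkseq => jk; rewrite nth_mkseq //.
by apply: h; rewrite /= mem_iota.
Qed.

(** The event is a finite union of cylinders, one for each value in [S] of the first [k] bits. *)
Lemma measurable_bits k (S : set word) : measurable [set o | S (bits k o)].
Proof.
have -> : [set o | S (bits k o)] =
    \bigcup_(t in [set t : k.-tuple bool | S t]) [set o | bits k o = t].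
  apply/seteqP; split=> o /=; last by move=> [t St] /= ->.
  have sz : size (bits k o) == k by rewrite size_mkseq.
  by move=> So; exists (Tuple sz).
apply: fin_bigcup_measurable => [|t _]; first exact: finite_finset.
rewrite bits_setE ?size_tuple //.
by apply: fin_bigcap_measurable => [|j _]; [exact: finite_seq|exact: measurable_bit].
Qed.

Lemma word_law k u : size u = k -> P [set o | bits k o = u] = (wprob p u)%:E.
Proof.
move=> uk; rewrite bits_setE //.
rewrite (iidX.2 _ (fun j => [set nth false u j])) ?iota_uniq //.
under eq_bigr do rewrite bit_law.
rewrite prodEFin wprobE [in RHS](big_nth false) uk.
by rewrite /index_iota subn0.
Qed.

Lemma take_bits k l o : take k (bits (k + l)%N o) = bits k o.
Proof. by rewrite /bits /mkseq -map_take take_iota (minn_idPl (leq_addr _ _)). Qed.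

(** Splitting over the value [t] of the first [k] bits gives the words [t ++ v], whose probability
    factorizes. *)
Lemma bits_extend_law k (S : set word) v :
  P [set o | S (bits k o) /\ bits (k + size v)%N o = bits k o ++ v] =
  ((\sum_(t : k.-tuple bool | `[< S t >]) wprob p t) * wprob p v)%:E.
Proof.
have -> : [set o | S (bits k o) /\ bits (k + size v)%N o = bits k o ++ v] =
    \bigcup_(t in [set` enum [pred t : k.-tuple bool | `[< S t >]]])
      [set o | bits (k + size v)%N o = t ++ v].
  have sz o : size (bits k o) == k by rewrite size_mkseq.
  apply/seteqP; split=> o /=.
    move=> [So e]; exists (Tuple (sz o)) => //=.
    by rewrite mem_enum; apply/asboolP; exact: So.
  move=> [t /=]; rewrite mem_enum => /asboolP St e.
  suff -> : bits k o = t by [].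
  have := congr1 (take k) e; rewrite take_size_cat ?size_tuple // => <-.
  by rewrite take_bits.
rewrite measure_fin_bigcup //.
- rewrite -fsbig_seq ?enum_uniq // big_enum /=.
  under eq_bigr do rewrite word_law ?size_cat ?size_tuple // wprob_cat.
  by rewrite sumEFin mulr_suml.
- move=> s t _ _ [ou [/= -> /eqP]]; rewrite eqseq_cat ?size_tuple //.
  by move=> /andP[/eqP e _]; apply: val_inj.
- move=> t _; exact: (measurable_bits _ [set u | u = t ++ v]).
Qed.

Lemma bits_law k (S : set word) :
  P [set o | S (bits k o)] = (\sum_(t : k.-tuple bool | `[< S t >]) wprob p t)%:E.
Proof.
(* This is the case [v = [::]] of [bits_extend_law]. *)
rewrite -[X in X%:E]mulr1.
have w1 : wprob p [::] = 1 by rewrite wprobE big_nil.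
rewrite -w1 -bits_extend_law; congr (P _); apply/seteqP; split=> o /=.
  by rewrite addn0 cats0.
by case.
Qed.

(* The next |v| bits are independent of the past and spell [v] with probability
   [wprob p v]. *)
Lemma avoiding_decay v k :
  (P [set o | ~~ infix v (bits (k + size v)%N o)] <=
   P [set o | ~~ infix v (bits k o)] * (1 - wprob p v)%:E)%E.
Proof.
pose S : set word := [set u | ~~ infix v u].
pose hit := [set o | S (bits k o) /\ bits (k + size v)%N o = bits k o ++ v].
have mS j : measurable [set o | S (bits j o)] by exact: measurable_bits.
have tk o : take k (bits (k + size v)%N o) = bits k o by exact: take_bits.
have mhit : measurable hit.
  have -> : hit = [set o | [set u | S (take k u) /\ u = take k u ++ v]
                             (bits (k + size v)%N o)].
    by apply/seteqP; split=> o /=; rewrite tk.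
  exact: measurable_bits.
(* [hit] and avoidance up to [k + size v] are disjoint, and both lie in avoidance up to [k], so
   their probabilities add up to at most that of the latter. *)
have disj : hit `&` [set o | S (bits (k + size v)%N o)] = set0.
  apply/seteqP; split=> // o [/= [_ e]]; rewrite /S /= e => /negP; apply.
  exact: suffix_infix.
have sub : hit `|` [set o | S (bits (k + size v)%N o)] `<=` [set o | S (bits k o)].
  move=> o [[]//|]; apply: contra; rewrite -tk => /infix_trans; apply.
  exact: infix_take.
have : (P hit + P [set o | S (bits (k + size v)%N o)] <= P [set o | S (bits k o)])%E.
  rewrite -measureU //; apply: le_measure sub; rewrite inE //.
  exact: measurableU.
rewrite (bits_extend_law k S v) !(bits_law _ S) -EFinM -EFinD !lee_fin.
by rewrite mulrBr mulr1 lerBrDl.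
Qed.

Lemma wprob_le1 u : wprob p u <= 1.
Proof.
rewrite -lee_fin -(@word_law (size u)) //; apply: probability_le1.
exact: (measurable_bits _ [set t | t = u]).
Qed.

Lemma avoiding_le v m :
  (P [set o | ~~ infix v (bits (m * size v)%N o)] <= ((1 - wprob p v) ^+ m)%:E)%E.
Proof.
elim: m => [|m IHm].
  by rewrite expr0 probability_le1 //; exact: (measurable_bits _ [set u | ~~ infix v u]).
rewrite mulSn addnC exprSr EFinM; apply: le_trans (avoiding_decay v _) _.
by apply: lee_wpmul2r IHm; rewrite lee_fin subr_ge0 wprob_le1.
Qed.

(** [P A] lies below every power of [1 - wprob p v], a ratio less than 1 because [p] is in the open
    interval. *)
Lemma avoiding_null v (A : set T) : 0 < p < 1 -> measurable A ->
  (forall k, A `<=` [set o | ~~ infix v (bits k o)]) -> P A = 0%E.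
Proof.
move=> p01 mA Av; apply/eqP; rewrite eq_le measure_ge0 andbT.
have fA : P A \is a fin_num by exact: fin_num_measure.
rewrite -(fineK fA) lee_fin.
have le_m m : fine (P A) <= (1 - wprob p v) ^+ m.
  rewrite -lee_fin fineK //; apply: le_trans (avoiding_le v m).
  apply: le_measure (Av _); rewrite inE //.
  exact: (measurable_bits _ [set u | ~~ infix v u]).
have lt1 : `|1 - wprob p v| < 1.
  by rewrite ger0_norm ?subr_ge0 ?wprob_le1 // ltrBlDr ltrDl wprob_gt0.
by apply: (cvgr_to_ge (cvg_expr lt1)); near=> m; exact: le_m.
Unshelve. all: by end_near. Qed.

Lemma Win_bigcup v w : Win X v w = P (\bigcup_k [set o | Omega v w (bits k o)]).
Proof.
congr (P _); apply/seteqP; split=> o /=.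
  by move=> /tau_ltP[k Ok]; exists k.
by case=> k _ Ok; apply/tau_ltP; exists k.
Qed.

(** The winning time is unique by [Omega_mkseq_inj], so the events are disjoint and countable
    additivity applies. *)
Lemma Win_series v w :
  Win X v w = (\sum_(0 <= k <oo) P [set o | Omega v w (bits k o)])%E.
Proof.
rewrite Win_bigcup measure_semi_bigcup //.
- by move=> k; exact: measurable_bits.
- by move=> k l _ _ [ou [/= Ok Ol]]; exact: Omega_mkseq_inj Ok Ol.
- by apply: bigcupT_measurable => k; exact: measurable_bits.
Qed.

(** If neither word wins, then [v] never occurs by [Omega_exhaust], an event of probability zero. *)
Lemma Win_total v w : 0 < p < 1 -> v != w -> size v = size w ->
  (Win X v w + Win X w v)%E = 1%E.
Proof.
move=> p01 nvw svw; rewrite !Win_bigcup.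
have mU a b : measurable (\bigcup_k [set o | Omega a b (bits k o)]).
  by apply: bigcupT_measurable => k; exact: measurable_bits.
set V := \bigcup_k _; set W := \bigcup_k _.
have disj : V `&` W = set0.
  apply/seteqP; split=> // o [[k _ /= Ov] [l _ /= Ow]].
  have : (tau R v (X^~ o) < tau R w (X^~ o))%E by apply/tau_ltP; exists k.
  have : (tau R w (X^~ o) < tau R v (X^~ o))%E by apply/tau_ltP; exists l.
  by move=> h1 /(lt_trans h1); rewrite ltxx.
rewrite -(measureU P (mU v w) (mU w v) disj) -[LHS]adde0.
have mC : measurable (~` (V `|` W)).
  by apply: measurableC; apply: measurableU; exact: mU.
have <- : P (~` (V `|` W)) = 0%E.
  apply: (avoiding_null (v := v)) => // k o nVW /=; apply/negP => /=.
  move=> /(Omega_exhaust nvw svw)[l [Ol|Ol]]; apply: nVW; [left|right]; by exists l.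
rewrite -measureU //; [by rewrite setUv; exact: probability_setT| |].
  by apply: measurableU; exact: mU.
by rewrite setICr.
Qed.

Lemma Omega_law_linked v w A B k : linked v w A B ->
  P [set o | Omega v w (bits k o)] = P [set o | Omega w v (bits k o)].
Proof.
move=> L; rewrite !bits_law; congr _%:E.
(* [replace_end] as a map on [k]-tuples: the default [t] of [insubd] is never taken on words of
   [Omega], whose length is preserved. *)
pose h a b A B (t : k.-tuple bool) : k.-tuple bool := insubd t (replace_end a b A B t).
have hE a b C D t : linked a b C D -> Omega a b (tval t) ->
    val (h a b C D t) = replace_end a b C D t.
  move=> L' /(replace_endP L')[_ pt _].
  by rewrite val_insubd (perm_size pt) size_tuple eqxx.
have key a b C D t : linked a b C D -> Omega a b (tval t) ->
    Omega b a (h a b C D t) /\ h b a D C (h a b C D t) = t.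
  move=> L' Ot; have [Ob _ K] := replace_endP L' Ot; rewrite hE //; split=> //.
  by apply: val_inj; rewrite hE ?hE //; exact: linked_sym.
have L' := linked_sym L.
rewrite [RHS](reindex_onto (h v w A B) (h w v B A)) /=; last first.
  by move=> t /asboolP /(key _ _ _ _ _ L')[].
(* Reindexing adds the condition that [h] can be undone at [t]; with it, the image condition amounts
   to [Omega v w t]. *)
have cond t : (`[< Omega w v (h v w A B t) >] && (h w v B A (h v w A B t) == t)) =
              `[< Omega v w t >].
  apply/andP/asboolP => [[/asboolP Oh /eqP <-]|Ot].
    exact: (key _ _ _ _ _ L' Oh).1.
  by have [Oh ->] := key _ _ _ _ _ L Ot; split=> //; apply/asboolP.
rewrite (eq_bigl _ _ cond); apply: eq_bigr => t /asboolP Ot.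
by rewrite hE //; apply: wprob_perm; rewrite perm_sym; have [] := replace_endP L Ot.
Qed.

Lemma Win_linked v w A B : 0 < p < 1 -> linked v w A B -> Win X v w = (2^-1)%:E.
Proof.
move=> p01 L; have sym : Win X v w = Win X w v.
  by rewrite !Win_series; apply: eq_eseriesr => k _; exact: Omega_law_linked L.
have svw := perm_size (linked_perm_words L).
(* The words differ in their prefixes [P] and [Q], here called [A] and [B], which have the same
   length. *)
have nvw : v != w.
  case: L => sAB _ nAB _ _ [B' -> _] [A' -> _] _ _.
  by rewrite eqseq_cat // negb_and nAB.
have := Win_total p01 nvw svw; rewrite -sym.
have fW : Win X v w \is a fin_num.
  rewrite Win_bigcup; apply: fin_num_measure.
  by apply: bigcupT_measurable => k; exact: measurable_bits.
rewrite -(fineK fW) -EFinD => -[h]; congr _%:E; lra.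
Qed.

End IidBits.

(** * The spaced family has all the required properties *)

Lemma spaced_inj A B : injective (spaced A B).
Proof. by move=> m n /(congr1 size); rewrite !size_spaced; lia. Qed.

Theorem theorem3p8 (R : realType) :
  exists E : set (word * word),
    [/\ forall v w : word, E (v, w) -> size v = size w,
        forall v w : word, E (v, w) ->
          (exists phi : word -> word,
             set_bij (Omega v w) (Omega w v) phi /\
             (forall x : word, Omega v w x ->
              forall p : R, 0 < p < 1 -> wprob p (phi x) = wprob p x)) /\
          (forall p : R, 0 < p < 1 ->
           forall (d : measure_display) (T : measurableType d)
                  (P : probability T R) (X : nat -> {RV P >-> bool}),
             iid_bits p X -> Win X v w = (2^-1 : R)%:E),
        polytime_decidable E &
        infinite_set (E `\` Rfam)].
Proof.
pose pair n := (spaced blockA blockB n, spaced blockB blockA n).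
exists (range pair); split.
- by move=> v w [n _ [<- <-]]; exact: perm_size (linked_perm_words (spaced_linked n)).
- move=> v w [n _ [<- <-]]; have L := spaced_linked n; split.
    exists (replace_end (spaced blockA blockB n) (spaced blockB blockA n)
              (blockA ++ nseq n true) (blockB ++ nseq n true)).
    split; first exact: replace_end_bij.
    by move=> x Ox q _; apply: wprob_perm; have [] := replace_endP L Ox.
  by move=> q q01 d T P X iidX; exact: (Win_linked iidX q01 L).
- exact: spaced_polytime.
- apply: (@sub_infinite_set _ (range pair)).
    by move=> _ [n _ <-]; split; [exists n|exact: linked_notin_R (spaced_linked n)].
  (* The length of the first word determines [n], so a finite range would make the set of naturals
     finite. *)
  move=> fin; apply: infinite_nat; rewrite -(preimage_range pair).
  by apply: finite_preimage fin => m n _ _ /(congr1 fst)/spaced_inj.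
Qed.
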